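(* For every finite simple graph $G$, $\tau(G)\leq \frac{63}{22}\,\nu(G)$.
   Context: A triangle in a graph $G$ is a subgraph isomorphic to $K_3$. $\nu(G)$ denotes the maximum number of pairwise edge-disjoint triangles in $G$. $\tau(G)$ denotes the minimum size of a triangle transversal of $G$, i.e. of a set of edges of $G$ that contains at least one edge of every triangle of $G$. *)

(* Defs.v *)
From mathcomp Require Import all_boot.

Set Implicit Arguments.
Unset Strict Implicit.
Unset Printing Implicit Defensive.

Record sgraph := SGraph {
  vertex :> finType;
  adj : rel vertex;
  adj_sym : symmetric adj;
  adj_irrefl : irreflexive adj }.

Definition edges (G : sgraph) : {set {set G}} :=
  [set E : {set G} | [exists x, exists y, adj x y && (E == [set x; y])]].

(* A subgraph isomorphic to K_3 is determined by its vertex set, so triangles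
   are represented by their vertex sets. *)
Definition triangles (G : sgraph) : {set {set G}} :=
  [set A : {set G} |
    (#|A| == 3) && [forall x in A, forall y in A, (x != y) ==> adj x y]].

Definition triangle_edges (G : sgraph) (A : {set G}) : {set {set G}} :=
  [set E in edges G | E \subset A].

Definition triangle_packing (G : sgraph) (P : {set {set G}}) : bool :=
  (P \subset triangles G) &&
  [forall A in P, forall B in P,
    (A != B) ==> [disjoint triangle_edges A & triangle_edges B]].

Definition nu (G : sgraph) : nat :=
  \max_(P : {set {set G}} | triangle_packing P) #|P|.

Definition triangle_transversal (G : sgraph) (F : {set {set G}}) : bool :=
  (F \subset edges G) &&
  [forall A in triangles G, F :&: triangle_edges A != set0].

(* The default [edges G] is itself a transversal (see [edges_transversal]), so
   the arg min is a transversal of minimum size. *)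
Definition tau (G : sgraph) : nat :=
  #|[arg min_(F < edges G | triangle_transversal F) #|F|]|.

Lemma edges_transversal (G : sgraph) : triangle_transversal (edges G).
Proof.
apply/andP; split=> //; apply/forall_inP => A; rewrite inE.
case/andP=> A3 /forall_inP cA.
have /card_gt1P [x [y [xA yA xy]]] : 1 < #|A| by rewrite (eqP A3).
have /implyP/(_ xy) exy := forall_inP (cA x xA) y yA.
apply/set0Pn; exists [set x; y].
have xyE : [set x; y] \in edges G.
  by rewrite inE; apply/existsP; exists x; apply/existsP; exists y; rewrite exy /=.
by rewrite in_setI xyE /= inE xyE /= subUset !sub1set xA yA.
Qed.

Lemma tau_min (G : sgraph) :
  (exists2 F : {set {set G}}, triangle_transversal F & #|F| = tau G) /\
  (forall F : {set {set G}}, triangle_transversal F -> tau G <= #|F|).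
Proof.
rewrite /tau; case: arg_minnP => [|F tF minF]; first exact: edges_transversal.
by split=> //; exists F.
Qed.

(* Main.v *)
Require Import Defs.
From mathcomp Require Import all_boot all_order all_algebra.
From mathcomp Require Import zify.

(** Fix a maximum packing [P], of [nu] triangles.  Every triangle has an edge in
    [P]; sort the triangles by the number of their edges in [P], their kind.

    If a packing [Q] comes with [j] edge-disjoint alternative triangles, each
    sharing an edge with its own member of [Q] and otherwise avoiding the edges
    of [Q], then any set of members can be exchanged for their alternatives.  A
    triangle that meets every packing so obtained, but neither an unpaired
    member of [Q] nor the edge shared by a pair, must meet both triangles [A]
    and [B] of some pair, hence contains the two vertices of the symmetric
    difference of [A] and [B].  So two edges per pair and three per other member
    form a transversal, of size [3 * #|Q| - j] ([exchange_cover]).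

    Let [S] be a maximal packing of triangles of kind 1.  Exchanging members of
    [P] for members of [S] gives [tau <= 3 * nu - #|S|] ([bound_pendant]).

    Next complete [S] to a packing [S :|: F :|: N], with [F] of kind 2 and [N]
    of kind 3, together with a set [L] of pairs made of a member of [F] and an
    alternative of kind 2 with the same edge outside [P].  Choose all this so
    that [11 * #|F| + 4 * #|N| + #|L|] is largest.  The weights make it
    profitable to add a triangle of kind 2 to [F] at the cost of two members of
    [N] and two pairs, and a triangle of kind 3 to [N] at the cost of three
    pairs.  Consequently every triangle of kind 2 meets [S] or [F], and every
    triangle meets [S :|: F :|: N], even after exchanges along [L].  Three
    further bounds follow:
    - exchanging along [L]: [tau <= 3 * (#|S| + #|F| + #|N|) - #|L|]
      ([bound_exchange]);
    - all edges of [S], [N] and of the alternatives, and the edges of [F] that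
      lie in [P]: [tau <= 3 * #|S| + 2 * #|F| + 3 * #|N| + 3 * #|L|]
      ([bound_greedy]);
    - all edges of [S], the edges of [F] that lie in [P], and half of the
      remaining edges of [F] and [P], namely those not crossing a large cut:
      [2 * tau <= 3 * nu + 5 * #|S| + 3 * #|F|] ([bound_cut]).

    Since [#|S| + #|F| + #|N| <= nu], a positive combination of the four bounds
    is [19 * tau <= 54 * nu], and 54/19 < 63/22. *)

Set Implicit Arguments.
Unset Strict Implicit.
Unset Printing Implicit Defensive.

Local Notation te := triangle_edges.

(** * Triangles, their edges, packings and transversals *)

(** All pairs of vertices of a triangle are adjacent, so adjacency need not be
    mentioned. *)
Lemma in_triangle_edges (G : sgraph) (A E : {set G}) :
  A \in triangles G -> (E \in te A) = (E \subset A) && (#|E| == 2).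
Proof.
rewrite inE => /andP[A3 /forall_inP cA]; rewrite !inE andbC.
case sEA: (E \subset A) => //=.
apply/existsP/cards2P => [[x /existsP[y /andP[xy /eqP->]]]|[x [y [xy defE]]]].
  by exists x, y; split=> //; apply: contraTneq xy => ->; rewrite adj_irrefl.
exists x; apply/existsP; exists y; rewrite defE eqxx andbT.
move: sEA; rewrite defE subUset !sub1set => /andP[xA yA].
by have /implyP := forall_inP (cA x xA) y yA; apply.
Qed.

Definition hits (G : sgraph) (A : {set G}) (X : {set {set G}}) : bool :=
  ~~ [disjoint te A & X].

Lemma hitsP (G : sgraph) (A : {set G}) (X : {set {set G}}) :
  reflect (exists2 E, E \in te A & E \in X) (hits A X).
Proof.
rewrite /hits -setI_eq0; apply: (iffP (set0Pn _)) => [[E /setIP[]]|[E EA EX]].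
  by exists E.
by exists E; rewrite inE EA.
Qed.

Lemma card_triangle (G : sgraph) (A : {set G}) : A \in triangles G -> #|A| = 3.
Proof. by rewrite inE => /andP[/eqP]. Qed.

Lemma card_triangle_edges (G : sgraph) (A : {set G}) :
  A \in triangles G -> #|te A| = 3.
Proof.
move=> tA; rewrite -[RHS]/('C(3, 2)) -(card_triangle tA) -cards_draws.
by apply: eq_card => E; rewrite in_triangle_edges // inE.
Qed.

Definition edges_in (G : sgraph) (Q : {set {set G}}) : {set {set G}} :=
  \bigcup_(A in Q) te A.

Lemma edges_inP (G : sgraph) (Q : {set {set G}}) E :
  reflect (exists2 A, A \in Q & E \in te A) (E \in edges_in Q).
Proof. by apply: (iffP bigcupP) => -[A]; exists A. Qed.

Lemma edges_inU (G : sgraph) (Q R : {set {set G}}) :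
  edges_in (Q :|: R) = edges_in Q :|: edges_in R.
Proof. exact: bigcup_setU. Qed.

(** An edge of a packing determines the member that it belongs to: the form in
    which disjointness is used throughout. *)
Lemma packingP (G : sgraph) (Q : {set {set G}}) :
  reflect ({subset Q <= triangles G} /\
           forall A B E, A \in Q -> B \in Q -> E \in te A -> E \in te B -> A = B)
          (triangle_packing Q).
Proof.
apply: (iffP andP) => [[/subsetP tQ /forall_inP dQ]|[tQ dQ]]; split=> //.
- move=> A B E AQ BQ EA EB; apply/eqP; apply: contraTT EB => AB.
  have /implyP/(_ AB) := forall_inP (dQ A AQ) B BQ.
  by move/disjointFr=> ->.
- exact/subsetP.
apply/forall_inP => A AQ; apply/forall_inP => B BQ; apply/implyP => AB.
rewrite disjoint_subset; apply/subsetP => E EA; rewrite inE /=.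
by apply: contra AB => EB; rewrite (dQ A B E).
Qed.

Lemma packing_le_nu (G : sgraph) (Q : {set {set G}}) :
  triangle_packing Q -> #|Q| <= nu G.
Proof.
move=> pQ.
exact: (@leq_bigmax_cond _ (@triangle_packing G) (fun R => #|R|)).
Qed.

Lemma max_packing (G : sgraph) :
  exists2 P : {set {set G}}, triangle_packing P & #|P| = nu G.
Proof.
have p0 : triangle_packing (set0 : {set {set G}}).
  by apply/packingP; split=> [A|A B E]; rewrite inE.
have [|P pP eP] := @eq_bigmax_cond _ (@triangle_packing G) (fun Q => #|Q|).
  by rewrite (cardD1 set0) [_ \in _]p0.
by exists P; rewrite // -eP.
Qed.

Lemma tau_le (G : sgraph) (X : {set {set G}}) :
  (forall A, A \in triangles G -> hits A X) ->
  tau G <= #|X|.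
Proof.
move=> hX; have [_ /(_ (X :&: edges G)) le_tau] := tau_min G.
apply: leq_trans (subset_leq_card (subsetIl X (edges G))).
apply: le_tau; apply/andP; split; first exact: subsetIr.
apply/forall_inP => A /hX/hitsP[E EA EX]; apply/set0Pn; exists E.
by rewrite !in_setI EX EA andbT; move: EA; rewrite inE => /andP[].
Qed.

Lemma triangle_edges_neq0 (G : sgraph) (A : {set G}) :
  A \in triangles G -> exists E, E \in te A.
Proof. by move=> tA; apply/card_gt0P; rewrite card_triangle_edges. Qed.

Lemma card_edges_inI (G : sgraph) (k : nat) (Q X : {set {set G}}) :
  triangle_packing Q -> (forall A, A \in Q -> #|te A :&: X| = k) ->
  #|edges_in Q :&: X| = k * #|Q|.
Proof.
move=> /packingP[tQ dQ] kQ.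
have [k0|k_gt0] := posnP k.
  rewrite k0; apply/eqP; rewrite cards_eq0 -subset0; apply/subsetP => E.
  rewrite inE => /andP[/edges_inP[A AQ EA] EX].
  by rewrite -(cards0_eq (etrans (kQ A AQ) k0)) inE EA.
transitivity #|\bigcup_(A in Q) (te A :&: X)|.
  by congr #|pred_of_set _|; rewrite /edges_in big_distrl.
pose f A := te A :&: X.
have injf : {in Q &, injective f}.
  move=> A B AQ BQ eAB.
  have /card_gt0P[E] : 0 < #|f A| by rewrite kQ.
  move=> EfA; move: (EfA); rewrite eAB => /setIP[EB _].
  by move: EfA => /setIP[EA _]; apply: dQ EA EB.
have trivf : trivIset (f @: Q).
  apply/trivIsetP => _ _ /imsetP[A AQ ->] /imsetP[B BQ ->] AB.
  rewrite disjoint_subset; apply/subsetP => E /setIP[EA _]; rewrite inE.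
  by apply: contra AB => /setIP[EB _]; rewrite (dQ A B E).
have -> : \bigcup_(A in Q) (te A :&: X) = cover (f @: Q).
  by rewrite cover_imset.
rewrite -(eqP trivf) big_imset //= (eq_bigr (fun=> k)) //.
by rewrite sum_nat_const mulnC.
Qed.

Lemma card_edges_in (G : sgraph) (Q : {set {set G}}) :
  triangle_packing Q -> #|edges_in Q| = 3 * #|Q|.
Proof.
move=> pQ; rewrite -[edges_in Q]setIT; apply: card_edges_inI => // A AQ.
by rewrite setIT card_triangle_edges //; have /packingP[tQ _] := pQ; apply: tQ.
Qed.

(** Let [E1] be an edge of [A] and [E2] an edge of [B], both in [T].  If one of
    them is the common edge of [A] and [B], it is in [T].  Otherwise [E1]
    contains the vertex of [A] outside [B] and [E2] that of [B] outside [A], and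
    these two vertices form an edge of [T]. *)
Lemma hits_two_triangles (G : sgraph) (A B T : {set G}) E E1 E2 :
  A \in triangles G -> B \in triangles G -> T \in triangles G -> A != B ->
  E \in te A -> E \in te B ->
  E1 \in te T -> E1 \in te A -> E2 \in te T -> E2 \in te B ->
  hits T [set A :&: B; (A :\: B) :|: (B :\: A)].
Proof.
move=> tA tB tT AB; rewrite !in_triangle_edges //.
case/andP=> EA /eqP E2c /andP[EB _] /andP[E1T /eqP E1c] /andP[E1A _].
case/andP=> E2T /eqP E2c' /andP[E2B _].
have cA := card_triangle tA; have cB := card_triangle tB.
have cI : #|A :&: B| = 2.
  apply/eqP; rewrite eqn_leq -{2}E2c subset_leq_card ?subsetI ?EA //= andbT.
  rewrite -ltnS -cA proper_card // properE subsetIl /=.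
  apply: contra AB => sAI; rewrite eqEcard cA cB leqnn andbT.
  by apply: subset_trans sAI (subsetIr _ _).
have [sI|nI] := boolP (A :&: B \subset T).
  apply/hitsP; exists (A :&: B); last by rewrite !inE eqxx.
  by rewrite in_triangle_edges // sI cI.
have aux (X Y F : {set G}) : #|X| = 3 -> #|X :&: Y| = 2 -> X :&: Y = A :&: B ->
    F \subset T -> F \subset X -> #|F| = 2 -> X :\: Y \subset T.
  move=> cX cXY eXY FT FX cF.
  have /eqP/cards1P[c defc] : #|X :\: Y| = 1.
    by have := cardsID Y X; rewrite cX cXY; clear; lia.
  rewrite defc sub1set; apply: contraR nI => cT.
  suff <- : F = A :&: B by [].
  apply/eqP; rewrite -eXY eqEcard cXY cF leqnn andbT.
  apply/subsetP => z zF; rewrite inE (subsetP FX) //=.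
  apply: contraR cT => zY; suff <- : z = c by apply: (subsetP FT).
  by apply/set1P; rewrite -defc inE zY (subsetP FX).
apply/hitsP; exists ((A :\: B) :|: (B :\: A)); last by rewrite !inE eqxx orbT.
rewrite in_triangle_edges // subUset (aux A B E1) ?(aux B A E2) //=;
  try by rewrite setIC.
rewrite cardsU (_ : _ :&: _ = set0) ?cards0 ?subn0; last first.
  by apply/setP => z; rewrite !inE; case: (z \in A); case: (z \in B).
have := cardsID B A; have := cardsID A B; rewrite [B :&: A]setIC cI cA cB.
by clear; lia.
Qed.

(** Let [U] be a random set of vertices.  Each edge meets [U] in exactly one
    vertex with probability 1/2, so for some [U] at most half of the edges in [Y]
    do not cross the cut defined by [U].  A triangle has two vertices on the
    same side, hence an edge that does not cross. *)
Lemma half_cover (G : sgraph) (Y : {set {set G}}) :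
  Y \subset edges G ->
  exists C : {set {set G}}, 2 * #|C| <= #|Y| /\
    forall A, A \in triangles G -> te A \subset Y -> hits A C.
Proof.
move=> sY.
pose C (U : {set G}) := [set E in Y | ~~ odd #|E :&: U|].
pose D (U : {set G}) := [set E in Y | odd #|E :&: U|].
have CD U : #|C U| + #|D U| = #|Y|.
  rewrite -(cardsID (D U) Y) addnC; congr (_ + _); apply: eq_card => E;
  rewrite !inE; first by rewrite andbA andbb.
  by case: (E \in Y) => //=; rewrite andbT.
have hit U A : A \in triangles G -> te A \subset Y -> hits A (C U).
  move=> tA /subsetP sA.
  have [W [sWA W2 Wodd]] : exists W : {set G},
      [/\ W \subset A, 2 <= #|W| & W :&: U = W \/ W :&: U = set0].
    have c3 := cardsID U A; rewrite (card_triangle tA) in c3.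
    have [le2|gt2] := leqP 2 #|A :&: U|.
      by exists (A :&: U); rewrite subsetIl -setIA setIid; split=> //; left.
    exists (A :\: U); rewrite subsetDl; split=> //.
      by move: c3 gt2; clear; lia.
    by right; rewrite setIDAC setDIl setDv setI0.
  have [x [y [xW yW xy]]] := card_gt1P W2.
  have sEW : [set x; y] \subset W by rewrite subUset !sub1set xW yW.
  have Ete : [set x; y] \in te A.
    by rewrite in_triangle_edges // cards2 xy (subset_trans sEW).
  apply/hitsP; exists [set x; y] => //; rewrite inE sA //=.
  have [WU|WU] := Wodd.
    rewrite (setIidPl _) ?cards2 ?xy //.
    by apply: subset_trans sEW _; rewrite -WU subsetIr.
  suff -> : [set x; y] :&: U = set0 by rewrite cards0.
  by apply/eqP; rewrite -subset0 -WU setSI.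
(* Moving one end [x] of an edge across the cut is an involution on the cuts
   that changes whether the edge crosses; hence each edge crosses half of them. *)
pose tog (x : G) (U : {set G}) := [set z | (z \in U) (+) (z == x)].
have togK x : involutive (tog x).
  by move=> U; apply/setP => z; rewrite !inE addbK.
have odd_tog x U (E : {set G}) : x \in E ->
    odd #|E :&: tog x U| = ~~ odd #|E :&: U|.
  move=> xE; rewrite (cardsD1 x (E :&: U)) (cardsD1 x (E :&: tog x U)).
  have -> : (E :&: tog x U) :\ x = (E :&: U) :\ x.
    by apply/setP => z; rewrite !inE; case: (z == x); rewrite ?addbF.
  by rewrite !inE xE eqxx addbT /= !oddD; case: (x \in U) => //=; rewrite negbK.
have eqS : \sum_U #|C U| = \sum_U #|D U|.
  have sumE (p : {set G} -> {set G} -> bool) :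
      \sum_U #|[set E in Y | p E U]| = \sum_(E in Y) \sum_U p E U.
    rewrite exchange_big; apply: eq_bigr => U _.
    rewrite -sum1dep_card big_mkcondr; apply: eq_bigr => E _.
    by case: (p E U).
  rewrite !sumE; apply: eq_bigr => E EY.
  have /card_gt0P[x xE] : 0 < #|E|.
    move: (subsetP sY E EY); rewrite inE => /existsP[x /existsP[y /andP[_ /eqP->]]].
    by apply/card_gt0P; exists x; rewrite !inE eqxx.
  rewrite (reindex_inj (inv_inj (togK x))); apply: eq_bigr => U _.
  by rewrite odd_tog // negbK.
suff [U leU] : exists U, #|C U| <= #|D U|.
  by exists (C U); split; [move: (CD U) leU; clear; lia | exact: hit].
apply/existsP; apply: contraT; rewrite negb_exists => /forallP ltU.
suff : \sum_U #|D U| < \sum_U #|C U| by rewrite eqS ltnn.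
rewrite (bigD1 set0) //= [ltnRHS](bigD1 set0) //= -addSn leq_add //.
  by rewrite ltnNge ltU.
by apply: leq_sum => U _; rewrite ltnW // ltnNge ltU.
Qed.

(** * Exchanging members of a packing for alternative triangles *)

(** Cardinals of the same set may refer to its finite type in different but
    convertible ways; unfolding [reverse_coercion] makes them syntactically
    equal. *)
Ltac setlia := clear; unfold reverse_coercion in *; lia.

Lemma leq_card_bigcup (I T : finType) (D : {set I}) (f : I -> {set T}) k :
  (forall i, i \in D -> #|f i| <= k) -> #|\bigcup_(i in D) f i| <= k * #|D|.
Proof.
move=> fk; rewrite mulnC -sum_nat_const.
apply: (@leq_trans (\sum_(i in D) #|f i|)); last exact: leq_sum.
apply: (big_ind2 (fun (A : {set T}) n => #|A| <= n)) => //; first by rewrite cards0.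
move=> A m B n Am Bn; apply: leq_trans (leq_add Am Bn).
by rewrite cardsU leq_subr.
Qed.

Lemma leq_card_disjoint (I T : finType) (D : {set I}) (f : I -> {set T})
    (X : {set T}) :
  (forall i, i \in D -> exists2 x, x \in f i & x \in X) ->
  (forall i j x, i \in D -> j \in D -> x \in f i -> x \in f j -> i = j) ->
  #|D| <= #|X|.
Proof.
move=> fX fD; have [->|[i0 i0D]] := set_0Vmem D; first by rewrite cards0.
have [x0 _ _] := fX i0 i0D.
pose h i := odflt x0 [pick x in f i :&: X].
have hP i : i \in D -> (h i \in f i) && (h i \in X).
  move=> iD; rewrite /h; case: pickP => [x|/= no]; first by rewrite inE.
  by have [x xf xX] := fX i iD; have := no x; rewrite inE xf xX.
rewrite -(card_in_imset (f := h)) => [|i j iD jD eh].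
  by apply/subset_leq_card/subsetP => _ /imsetP[i /hP/andP[_ ?] ->].
have /andP[hi _] := hP i iD; have /andP[hj _] := hP j jD.
by apply: fD hj; rewrite // -eh.
Qed.

Lemma packingU1 (G : sgraph) (T : {set G}) (Q : {set {set G}}) :
  triangle_packing Q -> T \in triangles G -> ~~ hits T (edges_in Q) ->
  triangle_packing (T |: Q).
Proof.
move=> /packingP[tQ dQ] tT nT.
have nQ A E : A \in Q -> E \in te A -> E \in te T -> False.
  by move=> AQ EA ET; case/hitsP: nT; exists E => //; apply/edges_inP; exists A.
apply/packingP; split=> [A /setU1P[->|/tQ] //|A B E].
case/setU1P=> [->|AQ] /setU1P[->|BQ] // EA EB; last exact: dQ EA EB.
  by case: (nQ B E).
by case: (nQ A E).
Qed.

Lemma notin_packing (G : sgraph) (T : {set G}) (Q : {set {set G}}) :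
  T \in triangles G -> ~~ hits T (edges_in Q) -> T \notin Q.
Proof.
move=> /triangle_edges_neq0[E ET]; apply: contra => TQ.
by apply/hitsP; exists E => //; apply/edges_inP; exists T.
Qed.

Lemma packingS (G : sgraph) (Q R : {set {set G}}) :
  Q \subset R -> triangle_packing R -> triangle_packing Q.
Proof.
move=> /subsetP sQR /packingP[tR dR]; apply/packingP; split=> [A /sQR/tR //|].
by move=> A B E /sQR AR /sQR BR; apply: dR.
Qed.

Lemma edges_inS (G : sgraph) (Q R : {set {set G}}) :
  Q \subset R -> edges_in Q \subset edges_in R.
Proof.
move=> /subsetP sQR; apply/subsetP => E /edges_inP[A /sQR AR EA].
by apply/edges_inP; exists A.
Qed.

Lemma hitsS (G : sgraph) (A : {set G}) (X Y : {set {set G}}) :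
  X \subset Y -> hits A X -> hits A Y.
Proof.
by move=> /subsetP sXY /hitsP[E EA /sXY EY]; apply/hitsP; exists E.
Qed.

(** The pairs [(A, B)] of [L] are possible exchanges: [B] may replace the member
    [A] of [Q].  Distinct pairs have edge-disjoint alternatives [B], so any
    subset of the exchanges can be made at once. *)
Definition linked (G : sgraph) (Q : {set {set G}})
    (L : {set {set G} * {set G}}) :=
  [/\ forall p, p \in L -> [/\ p.1 \in Q, p.2 \in triangles G, p.2 \notin Q
                             & hits p.2 (te p.1)],
      forall p E, p \in L -> E \in te p.2 -> E \in edges_in Q -> E \in te p.1 &
      forall p p' E, p \in L -> p' \in L ->
        E \in te p.2 -> E \in te p'.2 -> p = p'].

Definition exchange (G : sgraph) (Q : {set {set G}})
    (L : {set {set G} * {set G}}) : {set {set G}} :=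
  (Q :\: [set p.1 | p in L]) :|: [set p.2 | p in L].

Lemma linkedS (G : sgraph) (Q : {set {set G}}) (K L : {set {set G} * {set G}}) :
  K \subset L -> linked Q L -> linked Q K.
Proof.
move=> /subsetP sKL [L1 L2 L3]; split=> [p /sKL/L1 //|p E /sKL|p p' E /sKL pL /sKL].
  exact: L2.
exact: L3.
Qed.

Lemma exchange_packing (G : sgraph) (Q : {set {set G}}) L :
  triangle_packing Q -> linked Q L -> triangle_packing (exchange Q L).
Proof.
move=> /packingP[tQ dQ] [L1 L2 L3].
have cross A p E : A \in Q :\: [set q.1 | q in L] -> p \in L ->
    E \in te A -> E \in te p.2 -> False.
  case/setDP=> AQ nA pL EA Ep; case/negP: nA; apply/imsetP; exists p => //.
  have [p1Q _ _ _] := L1 p pL.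
  by apply: (dQ _ _ E) => //; apply: L2 => //; apply/edges_inP; exists A.
apply/packingP; split=> [A|A B E].
  case/setUP=> [/setDP[/tQ] //|/imsetP[p pL ->]].
  by have [] := L1 p pL.
case/setUP=> [AQ|/imsetP[p pL ->]] /setUP[BQ|/imsetP[p' p'L ->]] EA EB.
- by move: AQ BQ => /setDP[AQ _] /setDP[BQ _]; apply: dQ EA EB.
- by case: (cross A p' E).
- by case: (cross B p E).
- by rewrite (L3 p p' E).
Qed.

Lemma linked_inj2 (G : sgraph) (Q : {set {set G}}) L :
  linked Q L -> {in L &, injective (fun p => p.2)}.
Proof.
case=> L1 _ L3 p p' pL p'L e2; have [_ /triangle_edges_neq0[E Ep] _ _] := L1 p pL.
by apply: (L3 _ _ E); rewrite -?e2.
Qed.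

Lemma linked_sub1 (G : sgraph) (Q : {set {set G}}) L :
  linked Q L -> [set p.1 | p in L] \subset Q.
Proof.
by case=> L1 _ _; apply/subsetP => _ /imsetP[p /L1[pQ _ _ _] ->].
Qed.

(** The formula allows several pairs to share their member of [Q]: if they do,
    exchanging enlarges the packing. *)
Lemma card_exchange (G : sgraph) (Q : {set {set G}}) L : linked Q L ->
  #|exchange Q L| = #|Q| - #|[set p.1 | p in L]| + #|L|.
Proof.
move=> lL; have [L1 _ _] := lL.
rewrite /exchange cardsU (_ : _ :&: _ = set0) ?cards0 ?subn0; last first.
  apply/setP => A; rewrite !inE; apply: contraTF isT.
  case/andP=> /andP[_ AQ] /imsetP[p /L1[_ _ /negP nQ _] eA].
  by case: nQ; rewrite -eA.
rewrite (card_in_imset (linked_inj2 lL)) cardsD (setIidPr _) //.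
exact: linked_sub1.
Qed.

(** The transversal takes, for a pair [(A, B)] of [L], the common edge of [A] and
    [B] and the pair of vertices in their symmetric difference, and all three
    edges of every unpaired member of [Q]. *)
Lemma exchange_cover (G : sgraph) (Q : {set {set G}}) L :
  triangle_packing Q -> linked Q L -> {in L &, injective (fun p => p.1)} ->
  (forall (K : {set {set G} * {set G}}) T, K \subset L -> T \in triangles G ->
     hits T (edges_in (exchange Q K))) ->
  tau G + #|L| <= 3 * #|Q|.
Proof.
move=> /packingP[tQ dQ] lL inj1 hK; have [L1 L2 L3] := lL.
pose X (p : {set G} * {set G}) :=
  [set p.1 :&: p.2; (p.1 :\: p.2) :|: (p.2 :\: p.1)].
pose R := Q :\: [set p.1 | p in L].
have cR : #|edges_in R| <= 3 * #|R|.
  by apply: leq_card_bigcup => A /setDP[/tQ tA _]; rewrite card_triangle_edges.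
have cX : #|\bigcup_(p in L) X p| <= 2 * #|L|.
  by apply: leq_card_bigcup => p _; rewrite cards2; case: (_ != _).
have eR : #|R| + #|L| = #|Q|.
  rewrite -(card_in_imset inj1) addnC -(cardsID [set p.1 | p in L] Q).
  by rewrite (setIidPr (linked_sub1 lL)).
have [cU _] := leq_card_setU (edges_in R) (\bigcup_(p in L) X p).
suff : tau G <= #|edges_in R :|: \bigcup_(p in L) X p| by move: cU cX cR eR; setlia.
apply: tau_le => T tT.
(* Exchanging exactly the members that [T] meets forces [T] to meet an unpaired
   member, or both triangles of some pair. *)
pose K := [set p in L | hits T (te p.1)].
have sK : K \subset L by apply/subsetP => p; rewrite inE => /andP[].
have /hitsP[E ET /edges_inP[A]] := hK K T sK tT.
case/setUP=> [/setDP[AQ nA] EA|/imsetP[p pK ->] Ep].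
  apply/hitsP; exists E => //; rewrite inE; apply/orP; left.
  apply/edges_inP; exists A => //; rewrite inE AQ andbT.
  apply: contra nA => /imsetP[p pL eA]; apply/imsetP; exists p => //.
  by rewrite inE pL; apply/hitsP; exists E; rewrite // -eA.
have pL := subsetP sK p pK.
move: pK; rewrite inE => /andP[_ /hitsP[E1 E1T E1p]].
have [p1Q p2t p2Q /hitsP[E0 E02 E01]] := L1 p pL.
apply: (@hitsS _ _ (X p)); last first.
  apply: (@hits_two_triangles _ _ _ _ E0 E1 E) => //; first exact: tQ.
  by apply: contraNneq p2Q => <-.
apply: subset_trans (subsetUr _ _).
by apply: (bigcup_sup p).
Qed.

(** * Optimal configurations *)

Definition kind (G : sgraph) (P : {set {set G}}) (A : {set G}) : nat :=
  #|te A :&: edges_in P|.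

Section Config.

Variables (G : sgraph) (P S : {set {set G}}).
Hypothesis packP : triangle_packing P.
Hypothesis hitP : forall T, T \in triangles G -> hits T (edges_in P).
Hypothesis packS : triangle_packing S.
Hypothesis kindS : forall A, A \in S -> kind P A = 1.
Hypothesis hitS : forall T, T \in triangles G -> kind P T = 1 -> hits T (edges_in S).

Implicit Types (F N : {set {set G}}) (L K : {set {set G} * {set G}}).

(** The last two clauses concern the pairs [(A, B)] of [L]: outside [P], the
    triangle [B] has a single edge, which it shares with [A] in [F], and its two
    edges in [P] are free. *)
Definition config F N L : bool :=
  [&& triangle_packing (S :|: F :|: N),
      [forall A in F, kind P A == 2], [forall A in N, kind P A == 3],
      [forall p in L, [&& p.1 \in F, p.2 \in triangles G, kind P p.2 == 2,
         te p.2 :\: edges_in P \subset te p.1 &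
         [disjoint te p.2 :&: edges_in P & edges_in (S :|: F :|: N)]]] &
      [forall p in L, forall p' in L,
         (p != p') ==> [disjoint te p.2 & te p'.2]]].

Definition flexible F N (p : {set G} * {set G}) : Prop :=
  [/\ p.1 \in F, p.2 \in triangles G, kind P p.2 = 2,
      forall E, E \in te p.2 -> E \notin edges_in P -> E \in te p.1 &
      forall E, E \in te p.2 -> E \in edges_in P -> E \notin edges_in (S :|: F :|: N)].

Lemma configP F N L :
  reflect [/\ triangle_packing (S :|: F :|: N),
              forall A, A \in F -> kind P A = 2,
              forall A, A \in N -> kind P A = 3,
              forall p, p \in L -> flexible F N p &
              forall p p' E, p \in L -> p' \in L ->
                E \in te p.2 -> E \in te p'.2 -> p = p']
          (config F N L).
Proof.
apply: (iffP and5P) => -[pQ kF kN fL dL].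
  split=> // [A AF|A AN|p pL|p p' E pL p'L Ep Ep'].
  - exact/eqP/(forall_inP kF).
  - exact/eqP/(forall_inP kN).
  - have /and5P[p1F p2t /eqP k2 /subsetP sh di] := forall_inP fL p pL.
    split=> // E Ep EP; first by apply: sh; rewrite inE EP.
    by rewrite (disjointFr di) // inE Ep.
  apply/eqP; apply: contraTT Ep' => pp'.
  have /implyP/(_ pp') := forall_inP (forall_inP dL p pL) p' p'L.
  by move/disjointFr=> ->.
split=> //; first by apply/forall_inP => A /kF ->.
- by apply/forall_inP => A /kN ->.
- apply/forall_inP => p /fL[p1F p2t k2 sh di]; apply/and5P; split=> //.
  + by rewrite k2.
  + by apply/subsetP => E /setDP[Ep EP]; apply: sh.
  + rewrite disjoint_subset; apply/subsetP => E /setIP[Ep EP].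
    by rewrite inE /=; apply: di.
apply/forall_inP => p pL; apply/forall_inP => p' p'L; apply/implyP => pp'.
rewrite disjoint_subset; apply/subsetP => E Ep; rewrite inE /=.
by apply: contra pp' => Ep'; rewrite (dL p p' E).
Qed.

(** The requirements on the weights [f] of [F], [n] of [N] and 1 of [L] are
    [f > 2 * n + 2] and [n > 3]; see [optimal_hits2] and [optimal_hits]. *)
Definition weight F N L := 11 * #|F| + 4 * #|N| + #|L|.

Definition optimal F N L :=
  config F N L /\
  forall F' N' L', config F' N' L' -> weight F' N' L' <= weight F N L.

Lemma exists_optimal : exists F N L, optimal F N L.
Proof.
have c0 : config set0 set0 set0.
  by apply/configP; split=> [|A|A|p|p p' E]; rewrite ?setU0 // inE.
pose cf (c : {set {set G}} * {set {set G}} * {set {set G} * {set G}}) :=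
  config c.1.1 c.1.2 c.2.
pose w (c : {set {set G}} * {set {set G}} * {set {set G} * {set G}}) :=
  weight c.1.1 c.1.2 c.2.
have [[[F N] L] cF maxF] := @arg_maxnP _ (set0, set0, set0) cf w c0.
by exists F, N, L; split=> // F' N' L' c'; apply: (maxF (F', N', L')).
Qed.

Lemma kind3 A : A \in triangles G -> kind P A = 3 -> te A \subset edges_in P.
Proof.
move=> tA k3; apply/setIidPl/eqP; rewrite eqEcard subsetIl.
by rewrite card_triangle_edges // -k3 leqnn.
Qed.

Lemma kind_cases A : A \in triangles G ->
  [\/ kind P A = 1, kind P A = 2 | kind P A = 3].
Proof.
move=> tA; have : kind P A <= 3.
  by rewrite -(card_triangle_edges tA) subset_leq_card ?subsetIl.
have : 0 < kind P A.
  have /hitsP[E EA EP] := hitP tA.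
  by apply/card_gt0P; exists E; rewrite in_setI EA.
by case: (kind P A) => [|[|[|[|]]]] // _ _; [constructor 1|constructor 2|constructor 3].
Qed.

Lemma edges_inU3 (Q R T : {set {set G}}) E : E \in edges_in (Q :|: R :|: T) ->
  [\/ E \in edges_in Q, E \in edges_in R | E \in edges_in T].
Proof.
by rewrite !edges_inU !inE -orbA => /or3P[]; [constructor 1|constructor 2|constructor 3].
Qed.

Definition avoiding L (T : {set G}) := [set p in L | ~~ hits T (te p.2)].

(** A triangle avoiding [F] can meet alternatives of [L] only in edges of [P],
    since their other edges lie in [F]; thus it spoils at most [kind P T] pairs. *)
Lemma card_avoiding F N L T : config F N L -> T \in triangles G ->
  ~~ hits T (edges_in F) -> #|L| <= #|avoiding L T| + kind P T.
Proof.
case/configP=> pQ kF kN fL dL tT nF.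
rewrite -(cardsID (avoiding L T) L).
apply: leq_add; first by apply/subset_leq_card/subsetIr.
apply: (@leq_card_disjoint _ _ _ (fun p => te p.2)) => [p|p p' E].
  rewrite !inE negb_and negbK andbC => /andP[pL]; rewrite pL /=.
  case/hitsP=> E ET Ep; exists E; rewrite // inE ET /=.
  have [p1F _ _ sh _] := fL p pL.
  apply: contraR nF => EP; apply/hitsP; exists E => //.
  by apply/edges_inP; exists p.1 => //; apply: sh.
by case/setDP=> pL _ /setDP[p'L _] Ep Ep'; exact: (dL p p' E).
Qed.

Lemma config_avoiding F N L F' N' T : config F N L ->
  triangle_packing (S :|: F' :|: N') ->
  (forall A, A \in F' -> kind P A = 2) -> (forall A, A \in N' -> kind P A = 3) ->
  F \subset F' -> F' :|: N' \subset T |: (F :|: N) ->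
  config F' N' (avoiding L T).
Proof.
move=> /configP[pQ kF kN fL dL] pQ' kF' kN' /subsetP sF /subsetP sFN.
apply/configP; split=> // [p|p p' E]; last first.
  by move=> /setIdP[pL _] /setIdP[p'L _]; exact: dL.
rewrite inE => /andP[pL nT]; have [p1F p2t k2 sh di] := fL p pL.
split=> // [|E Ep EP]; first exact: sF.
have := di E Ep EP; apply: contra => /edges_inU3 EQ.
have ES : E \in edges_in S -> E \in edges_in (S :|: F :|: N).
  by rewrite !edges_inU !inE => ->.
have EFN A : A \in F' :|: N' -> E \in te A -> E \in edges_in (S :|: F :|: N).
  move=> /sFN/setU1P[->|AFN] EA.
    by case/hitsP: nT; exists E.
  by apply/edges_inP; exists A; rewrite // -setUA inE AFN orbT.
by case: EQ => [/ES //|/edges_inP[A AF]|/edges_inP[A AN]]; apply: EFN;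
  rewrite inE ?AF ?AN ?orbT.
Qed.

(** Otherwise add [T] to [F].  Each of its two edges in [P] meets at most one
    member of [N] and at most one alternative, so the weight grows by at least
    11 - 2 * 4 - 2. *)
Lemma optimal_hits2 F N L T : optimal F N L -> T \in triangles G ->
  kind P T = 2 -> ~~ hits T (edges_in S) -> hits T (edges_in F).
Proof.
move=> [cfg opt] tT k2 nS; case: (boolP (hits _ _)) => // nF; exfalso.
have [pQ kF kN fL dL] := configP _ _ _ cfg.
have [tQ dQ] := packingP _ pQ.
pose N' := [set A in N | ~~ hits T (te A)].
have nQ : ~~ hits T (edges_in (S :|: F :|: N')).
  apply/hitsP => -[E ET /edges_inU3[ES|EF|/edges_inP[A]]].
  - by case/hitsP: nS; exists E.
  - by case/hitsP: nF; exists E.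
  rewrite inE => /andP[_ /hitsP nA] EA; by case: nA; exists E.
have sQ : S :|: F :|: N' \subset S :|: F :|: N.
  by apply/setUS/subsetP => A; rewrite inE => /andP[].
have c' : config (T |: F) N' (avoiding L T).
  apply: (config_avoiding cfg).
  - rewrite (_ : S :|: _ :|: _ = T |: (S :|: F :|: N')); last first.
      by rewrite setUCA -!setUA.
    by apply: packingU1 => //; apply: packingS sQ pQ.
  - by move=> A /setU1P[->|/kF].
  - by move=> A; rewrite inE => /andP[/kN].
  - exact: subsetUr.
  - by rewrite -setUA; apply/setUS/setUS/subsetP => A; rewrite inE => /andP[].
have := opt _ _ _ c'; rewrite /weight cardsU1 notin_packing //.
have := card_avoiding cfg tT nF; rewrite k2.
suff : #|N| <= #|N'| + 2 by setlia.
rewrite -(cardsID N' N).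
apply: leq_add; first by apply/subset_leq_card/subsetIr.
rewrite -k2; apply: (@leq_card_disjoint _ _ _ (fun A => te A)) => [A|A B E].
  rewrite !inE negb_and negbK andbC => /andP[AN]; rewrite AN /=.
  case/hitsP=> E ET EA; exists E; rewrite // inE ET /=.
  by apply: (subsetP (kind3 (tQ A _) (kN A AN))) => //; rewrite inE AN orbT.
by case/setDP=> AN _ /setDP[BN _]; apply: (dQ A B E); rewrite inE ?AN ?BN orbT.
Qed.

(** A triangle of kind 3 avoiding the packing could be added to [N], at the cost
    of at most three pairs: the weight grows by at least 4 - 3. *)
Lemma optimal_hits F N L T : optimal F N L -> T \in triangles G ->
  hits T (edges_in (S :|: F :|: N)).
Proof.
move=> opt0 tT; have [cfg opt] := opt0; case: (boolP (hits _ _)) => // nQ; exfalso.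
have [pQ kF kN fL dL] := configP _ _ _ cfg.
have nS : ~~ hits T (edges_in S).
  by apply: contra nQ; apply/hitsS/edges_inS; rewrite -setUA subsetUl.
have nF : ~~ hits T (edges_in F).
  by apply: contra nQ; apply/hitsS/edges_inS; rewrite setUAC subsetUr.
have [k1|k2|k3] := kind_cases tT; first by rewrite (hitS tT k1) in nS.
  by rewrite (optimal_hits2 opt0) in nF.
have nN : T \notin N.
  apply: notin_packing => //.
  by apply: contra nQ; apply/hitsS/edges_inS; rewrite subsetUr.
have c' : config F (T |: N) (avoiding L T).
  apply: (config_avoiding cfg) => //.
  - by rewrite setUCA; apply: packingU1.
  - by move=> A /setU1P[->|/kN].
  - by rewrite setUCA.
have := opt _ _ _ c'; rewrite /weight cardsU1 nN.
have := card_avoiding cfg tT nF; rewrite k3; setlia.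
Qed.

Lemma card_config F N L : config F N L ->
  #|S :|: F :|: N| = #|S| + #|F| + #|N|.
Proof.
case/configP=> _ kF kN _ _.
have disj (X Y : {set {set G}}) k : (forall A, A \in X -> kind P A <= k) ->
    (forall A, A \in Y -> k < kind P A) -> #|X :|: Y| = #|X| + #|Y|.
  move=> kX kY; rewrite cardsU (_ : _ :&: _ = set0) ?cards0 ?subn0 //.
  apply/setP => A; rewrite !inE; apply/negbTE/negP => /andP[/kX le /kY].
  by rewrite ltnNge le.
rewrite (disj _ _ 2) ?(disj _ _ 1) // => [A /kindS-> //|A /kF-> //| |A /kN-> //].
by move=> A /setUP[/kindS->|/kF->].
Qed.

Lemma config_linked F N L : config F N L -> linked (S :|: F :|: N) L.
Proof.
case/configP=> pQ kF kN fL dL; have [tQ dQ] := packingP _ pQ.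
split=> // [p pL|p E pL Ep EQ].
  have [p1F p2t k2 sh di] := fL p pL; split=> //.
  - by rewrite !inE p1F orbT.
  - have /card_gt0P[E] : 0 < #|te p.2 :&: edges_in P| by rewrite [#|_|]k2.
    case/setIP=> Ep EP; apply: contra (di E Ep EP) => p2Q.
    by apply/edges_inP; exists p.2.
  have /card_gt0P[E] : 0 < #|te p.2 :\: edges_in P|.
    have := cardsID (edges_in P) (te p.2); rewrite card_triangle_edges //.
    by rewrite [X in X + _]k2; clear; lia.
  by case/setDP=> Ep EP; apply/hitsP; exists E; rewrite // sh.
have [p1F p2t k2 sh di] := fL p pL; apply: sh => //.
by apply: contraL EQ; apply: di.
Qed.

Lemma card_outside A : A \in triangles G -> kind P A = 2 -> #|te A :\: edges_in P| = 1.
Proof.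
move=> tA k2; have := cardsID (edges_in P) (te A); rewrite card_triangle_edges //.
by rewrite [X in X + _]k2; clear; lia.
Qed.

Lemma flexible_shared F N p : triangle_packing (S :|: F :|: N) ->
  (forall A, A \in F -> kind P A = 2) -> flexible F N p ->
  te p.1 :\: edges_in P = te p.2 :\: edges_in P.
Proof.
case/packingP=> tQ _ kF [p1F p2t k2 sh _].
have p1t : p.1 \in triangles G by apply: tQ; rewrite !inE p1F orbT.
apply/esym/eqP; rewrite eqEcard (card_outside p2t k2).
rewrite (card_outside p1t (kF _ p1F)) andbT.
by apply/subsetP => E /setDP[Ep EP]; rewrite in_setD EP sh.
Qed.

(** The edge outside [P] of a member of [F] can lie in a single alternative. *)
Lemma config_inj1 F N L : config F N L -> {in L &, injective (fun p => p.1)}.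
Proof.
case/configP=> pQ kF _ fL dL p p' pL p'L e1.
have [_ p2t k2 _ _] := fL p pL.
have /card_gt0P[E ED] : 0 < #|te p.2 :\: edges_in P| by rewrite card_outside.
apply: (dL p p' E) => //; first by case/setDP: ED.
move: ED; rewrite -(flexible_shared pQ kF (fL p pL)) e1.
by rewrite (flexible_shared pQ kF (fL p' p'L)) => /setDP[].
Qed.

Definition swap (p : {set G} * {set G}) := (p.2, p.1).

Definition swapped L K : {set {set G} * {set G}} := (L :\: K) :|: swap @: K.

(** A pair [(A, B)] plays symmetric roles: once [B] has replaced [A] in [F], [A]
    is an alternative to [B]. *)
Lemma exchange_config F N L K : config F N L -> K \subset L ->
  config (exchange F K) N (swapped L K).
Proof.
move=> cfg /subsetP sK; have inj1 := config_inj1 cfg.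
have lQ := config_linked cfg; have [l1 l2 l3] := lQ.
have [pQ kF kN fL dL] := configP _ _ _ cfg; have [tQ dQ] := packingP _ pQ.
have eQ : S :|: exchange F K :|: N = exchange (S :|: F :|: N) K.
  apply/setP => A; rewrite !inE.
  case: (boolP (A \in [set p.2 | p in K])) => [_|_]; rewrite ?orbT //= !orbF.
  case: (boolP (A \in [set p.1 | p in K])) => //= /imsetP[p /sK pL ->].
  have [p1F _ _ _ _] := fL p pL; rewrite orbF.
  have nS : p.1 \notin S by apply/negP => /kindS; rewrite kF.
  have nN : p.1 \notin N by apply/negP => /kN; rewrite kF.
  by rewrite (negbTE nS) (negbTE nN).
have pQ' : triangle_packing (S :|: exchange F K :|: N).
  by rewrite eQ; apply: exchange_packing => //; apply: linkedS lQ; apply/subsetP.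
have p2F p : p \in K -> p.2 \in exchange F K.
  by move=> pK; apply/setUP; right; apply/imsetP; exists p.
have covK E : E \in edges_in (exchange (S :|: F :|: N) K) ->
    (exists A, [/\ A \in S :|: F :|: N, E \in te A & A \notin [set p.1 | p in K]])
    \/ exists2 p, p \in K & E \in te p.2.
  case/edges_inP=> A /setUP[/setDP[AQ nA] EA|/imsetP[p pK ->] Ep]; first by left; exists A.
  by right; exists p.
apply/configP; split=> // [A|p|p p' E].
- case/setUP=> [/setDP[/kF] //|/imsetP[p /sK pL ->]].
  by have [] := fL p pL.
- case/setUP=> [/setDP[pL nK]|/imsetP[{}p pK ->]].
    have [p1F p2t k2 sh di] := fL p pL; split=> // [|E Ep EP].
      apply/setUP; left; rewrite inE p1F andbT; apply: contra nK.
      by case/imsetP=> p' p'K e1; rewrite (inj1 p p') // sK.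
    rewrite eQ; apply/negP => /covK[[A [AQ EA _]]|[p' p'K Ep']].
      by case/negP: (di E Ep EP); apply/edges_inP; exists A.
    by case/negP: nK; rewrite (dL p p' E) // sK.
  have pL := sK p pK; have fp := fL p pL; have [p1F p2t k2 sh di] := fp.
  have p1Q : p.1 \in S :|: F :|: N by rewrite !inE p1F orbT.
  split=> /= [||| E Ep EP|E Ep EP].
  - exact: p2F.
  - exact: tQ.
  - exact: kF.
  - by have /setDP[] : E \in te p.2 :\: edges_in P;
      rewrite // -(flexible_shared pQ kF fp) in_setD EP.
  rewrite eQ; apply/negP => /covK[[A [AQ EA nA]]|[p' p'K Ep']].
    by case/negP: nA; rewrite -(dQ p.1 A E) //; apply/imsetP; exists p.
  have [_ _ _ _ di'] := fL p' (sK p' p'K).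
  by case/negP: (di' E Ep' EP); apply/edges_inP; exists p.1.
have cross q q' : q \in L :\: K -> q' \in K -> E \in te q.2 -> E \in te q'.1 -> False.
  move=> /setDP[qL nK] q'K Eq Eq'; have q'L := sK q' q'K.
  have [q'1F _ _ _ _] := fL q' q'L; have [q1F _ _ sh di] := fL q qL.
  have q'1Q : q'.1 \in S :|: F :|: N by rewrite !inE q'1F orbT.
  have q1Q : q.1 \in S :|: F :|: N by rewrite !inE q1F orbT.
  have EQ : E \in edges_in (S :|: F :|: N) by apply/edges_inP; exists q'.1.
  case/negP: nK; rewrite (inj1 q q') //.
  apply: (dQ _ _ E) => //.
  by apply: sh => //; apply: contraL EQ; apply: di.
case/setUP=> [pL|/imsetP[q qK ->]] /setUP[p'L|/imsetP[q' q'K ->]] Ep Ep'.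
- by move: pL p'L => /setDP[pL _] /setDP[p'L _]; apply: dL Ep Ep'.
- by case: (cross p q').
- by case: (cross p' q).
have [q1F _ _ _ _] := fL q (sK q qK); have [q'1F _ _ _ _] := fL q' (sK q' q'K).
have e1 : q.1 = q'.1 by apply: (dQ _ _ E); rewrite // !inE ?q1F ?q'1F ?orbT.
by rewrite (inj1 q q') ?sK.
Qed.

Lemma exchange_weight F N L K : config F N L -> K \subset L ->
  weight (exchange F K) N (swapped L K) = weight F N L.
Proof.
move=> cfg sK; have lQ := config_linked cfg; have [l1 l2 l3] := lQ.
have [pQ kF kN fL dL] := configP _ _ _ cfg.
have sKP := subsetP sK.
have lF : linked F K.
  split=> [p pK|p E pK Ep EF|p p' E pK p'K].
  - have [p1F p2t _ _ _] := fL p (sKP p pK); have [_ _ nQ hp] := l1 p (sKP p pK).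
    by split=> //; apply: contra nQ => p2F; rewrite !inE p2F orbT.
  - apply: l2 => //; first exact: sKP.
    by apply: subsetP EF; apply: edges_inS; rewrite setUAC subsetUr.
  exact: dL (sKP p pK) (sKP p' p'K).
have inj1 : {in K &, injective (fun p => p.1)}.
  by move=> p p' /sKP pL /sKP p'L; apply: (config_inj1 cfg).
rewrite /weight card_exchange // card_in_imset // subnK; last first.
  by rewrite -(card_in_imset inj1) subset_leq_card // (linked_sub1 lF).
congr (_ + _); rewrite /swapped cardsU (_ : _ :&: _ = set0) ?cards0 ?subn0; last first.
  apply/setP => p; rewrite !inE; apply/negbTE/negP => /andP[/andP[_ pL]].
  case/imsetP=> q qK ep; have [p1F _ _ _ _] := fL p pL.
  have [_ _ /negP nQ _] := l1 q (sKP q qK); case: nQ.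
  by rewrite -[q.2]/(swap q).1 -ep !inE p1F orbT.
rewrite card_imset; last by move=> [a b] [c d] [-> ->].
by rewrite cardsD (setIidPr sK) subnK // subset_leq_card.
Qed.

(** * Upper bounds on the transversal number *)

(** After an exchange along [L] the configuration is still optimal, so every
    triangle still meets its packing; hence [exchange_cover] applies. *)
Lemma bound_exchange F N L : optimal F N L ->
  tau G + #|L| <= 3 * (#|S| + #|F| + #|N|).
Proof.
move=> [cfg opt]; rewrite -(card_config cfg).
have [pQ kF kN fL dL] := configP _ _ _ cfg.
apply: exchange_cover => //; first exact: config_linked cfg.
  exact: config_inj1 cfg.
move=> K T sK tT.
have optK : optimal (exchange F K) N (swapped L K).
  split; first exact: exchange_config.
  by move=> F' N' L' /opt; rewrite exchange_weight.
apply: hitsS (optimal_hits optK tT).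
apply: edges_inS; apply/subsetP => A; rewrite /exchange !inE.
have sF : A \in [set p.1 | p in K] -> A \in F.
  by case/imsetP=> p /(subsetP sK)/fL[p1F _ _ _ _] ->.
case: (boolP (A \in [set p.1 | p in K])) => [/sF AF|_] /=; last first.
  rewrite -!orbA; case: (A \in S) => //=; case: (A \in F) => //=.
  by rewrite orbC.
case: (boolP (A \in [set p.2 | p in K])) => _; rewrite ?orbT ?orbF //=.
by move=> /orP[/kindS|/kN]; rewrite kF.
Qed.

(** Let [T] miss these edges.  It is not of kind 1, as it misses [S]; nor of kind
    3, as it would meet the packing in an edge of [P].  So it has kind 2 and
    meets [F], in its only edge outside [P].  This edge lies in a member [A] of
    [F], and [(A, T)] could be added to [L]. *)
Lemma bound_greedy F N L : optimal F N L ->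
  tau G <= 3 * #|S| + 2 * #|F| + 3 * #|N| + 3 * #|L|.
Proof.
move=> opt0; have [cfg opt] := opt0.
have [pQ kF kN fL dL] := configP _ _ _ cfg; have [tQ dQ] := packingP _ pQ.
have sFQ : F \subset S :|: F :|: N by rewrite setUAC subsetUr.
have pF := packingS sFQ pQ.
have pN : triangle_packing N by apply: packingS pQ; rewrite subsetUr.
pose X0 := edges_in S :|: (edges_in F :&: edges_in P).
pose X := X0 :|: edges_in N :|: \bigcup_(p in L) te p.2.
have cX : #|X| <= 3 * #|S| + 2 * #|F| + 3 * #|N| + 3 * #|L|.
  have [c1 _] := leq_card_setU (X0 :|: edges_in N) (\bigcup_(p in L) te p.2).
  have [c2 _] := leq_card_setU X0 (edges_in N).
  have [c3 _] := leq_card_setU (edges_in S) (edges_in F :&: edges_in P).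
  have c4 : #|\bigcup_(p in L) te p.2| <= 3 * #|L|.
    by apply: leq_card_bigcup => p /fL[_ p2t _ _ _]; rewrite card_triangle_edges.
  have := card_edges_in packS; have := card_edges_in pN.
  have := card_edges_inI pF kF.
  move: c1 c2 c3 c4; rewrite /X /X0; setlia.
apply: leq_trans cX; apply: tau_le => T tT; case: (boolP (hits _ _)) => // nX; exfalso.
have nS : ~~ hits T (edges_in S).
  by apply: contra nX; apply: hitsS; rewrite /X /X0 -!setUA subsetUl.
have nN : ~~ hits T (edges_in N).
  by apply: contra nX; apply: hitsS; rewrite /X setUAC subsetUr.
have nFP : ~~ hits T (edges_in F :&: edges_in P).
  by apply: contra nX; apply: hitsS; rewrite /X /X0 -!setUA setUCA subsetUl.
have nL p E : p \in L -> E \in te p.2 -> E \in te T -> False.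
  move=> pL Ep ET; case/hitsP: nX; exists E => //; rewrite in_setU; apply/orP; right.
  by apply/bigcupP; exists p.
have nQP E : E \in te T -> E \in edges_in P -> E \notin edges_in (S :|: F :|: N).
  move=> ET EP; apply/negP => /edges_inU3[ES|EF|EN].
  - by case/hitsP: nS; exists E.
  - by case/hitsP: nFP; exists E; rewrite // in_setI EF.
  - by case/hitsP: nN; exists E.
have nQ3 : kind P T = 3 -> False.
  move=> k3; have /hitsP[E ET] := optimal_hits opt0 tT.
  by apply/negP; apply: nQP => //; apply: (subsetP (kind3 tT k3)).
have [k1|k2|/nQ3 //] := kind_cases tT; first by rewrite (hitS tT k1) in nS.
have /hitsP[E ET /edges_inP[A AF EA]] := optimal_hits2 opt0 tT k2 nS.
have EP : E \notin edges_in P.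
  apply/negP => EP; case/negP: (nQP E ET EP).
  by apply: subsetP (edges_inS sFQ) _ _; apply/edges_inP; exists A.
have flT : flexible F N (A, T).
  split=> //= E' E'T E'P; have /eqP/cards1P[E0 e0] := card_outside tT k2.
  have : E \in te T :\: edges_in P by rewrite in_setD EP.
  have : E' \in te T :\: edges_in P by rewrite in_setD E'P.
  by rewrite e0 => /set1P-> /set1P<-.
have c' : config F N ((A, T) |: L).
  apply/configP; split=> // [p /setU1P[-> //|/fL //]|p p' E'].
  case/setU1P=> [->|pL] /setU1P[->|p'L] //= Ep Ep'.
  - by case: (nL p' E').
  - by case: (nL p E').
  exact: dL Ep Ep'.
have nAL : (A, T) \notin L by apply/negP => /nL/(_ ET ET).
by have := opt _ _ _ c'; rewrite /weight cardsU1 nAL; setlia.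
Qed.

(** A triangle missing [S] and the edges common to [F] and [P] has kind 2 or 3,
    and if it has kind 2 its edge outside [P] lies in [F].  So all its edges are
    in [Y], and [half_cover] deals with it. *)
Lemma bound_cut F N L : optimal F N L ->
  2 * tau G <= 3 * #|P| + 5 * #|S| + 3 * #|F|.
Proof.
move=> opt0; have [cfg opt] := opt0.
have [pQ kF kN fL dL] := configP _ _ _ cfg; have [tQ dQ] := packingP _ pQ.
have sFQ : F \subset S :|: F :|: N by rewrite setUAC subsetUr.
have pF := packingS sFQ pQ.
pose Y1 := edges_in F :\: edges_in P.
pose Y2 := edges_in P :\: (edges_in S :|: edges_in F).
pose Y := Y1 :|: Y2.
have sY : Y \subset edges G.
  have sE Q : edges_in Q \subset edges G.
    by apply/subsetP => E /edges_inP[A _]; rewrite inE => /andP[].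
  by rewrite subUset !(subset_trans (subsetDl _ _)).
have [C [cC hC]] := half_cover sY.
pose X := edges_in S :|: (edges_in F :&: edges_in P) :|: C.
have cX : 2 * #|X| <= 3 * #|P| + 5 * #|S| + 3 * #|F|.
  have [c1 _] := leq_card_setU (edges_in S :|: (edges_in F :&: edges_in P)) C.
  have [c2 _] := leq_card_setU (edges_in S) (edges_in F :&: edges_in P).
  have [c3 _] := leq_card_setU Y1 Y2.
  have c4 := card_edges_inI pF kF.
  have c5 := card_edges_inI packS kindS.
  have c6 := cardsID (edges_in P) (edges_in F).
  have c7 := cardsID (edges_in S :|: edges_in F) (edges_in P).
  have c8 : #|edges_in P :&: (edges_in S :|: edges_in F)| =
      #|edges_in S :&: edges_in P| + #|edges_in F :&: edges_in P|.
    rewrite setIC setIUl cardsU.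
    rewrite (_ : edges_in S :&: _ :&: (edges_in F :&: _) = set0);
      first by rewrite cards0 subn0.
    apply/setP => E; rewrite in_set0 setIACA in_setI; apply/negbTE/negP => /andP[].
    case/setIP=> /edges_inP[A AS EA] /edges_inP[B BF EB] _.
    have eAB : A = B by apply: (dQ A B E); rewrite // !inE ?AS ?BF ?orbT.
    by have := kF B BF; rewrite -eAB kindS.
  have := card_edges_in packS; have := card_edges_in pF; have := card_edges_in packP.
  move: c1 c2 c3 c4 c5 c6 c7 c8 cC; rewrite /X /Y /Y1 /Y2; setlia.
suff : tau G <= #|X| by move: cX; setlia.
apply: tau_le => T tT; case: (boolP (hits _ _)) => // nX; exfalso.
have nS : ~~ hits T (edges_in S).
  by apply: contra nX; apply: hitsS; rewrite /X -!setUA subsetUl.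
have nFP : ~~ hits T (edges_in F :&: edges_in P).
  by apply: contra nX; apply: hitsS; rewrite /X -!setUA setUCA subsetUl.
have nC : ~~ hits T C by apply: contra nX; apply: hitsS; rewrite /X subsetUr.
case/negP: nC; apply: hC => //; apply/subsetP => E ET; rewrite in_setU !in_setD.
have nES : E \notin edges_in S by apply/negP => ES; case/hitsP: nS; exists E.
have nEF E' : E' \in te T -> E' \in edges_in P -> E' \notin edges_in F.
  by move=> ET' EP'; apply/negP => EF; case/hitsP: nFP; exists E'; rewrite // in_setI EF.
case: (boolP (E \in edges_in P)) => EP; first by rewrite in_setU negb_or nES nEF.
rewrite andTb andbF orbF.
have [k1|k2|k3] := kind_cases tT; first by rewrite (hitS tT k1) in nS.
  2: by case/negP: EP; apply: (subsetP (kind3 tT k3)).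
have /hitsP[E' ET' EF'] := optimal_hits2 opt0 tT k2 nS.
have EP' : E' \notin edges_in P by apply: contraL EF' => /nEF; apply.
have /eqP/cards1P[E0 e0] := card_outside tT k2.
have : E \in te T :\: edges_in P by rewrite in_setD EP.
have : E' \in te T :\: edges_in P by rewrite in_setD EP'.
by rewrite e0 => /set1P e' /set1P->; rewrite -e'.
Qed.

End Config.

(** Each [A] in [S] has a single edge in [P], in a single member of [P], for which
    it can be exchanged.  Two triangles of [S] with the same member would yield
    a larger packing, so [exchange_cover] applies with [#|S|] pairs. *)
Lemma bound_pendant (G : sgraph) (P S : {set {set G}}) :
  triangle_packing P -> #|P| = nu G -> triangle_packing S ->
  (forall A, A \in S -> kind P A = 1) ->
  tau G + #|S| <= 3 * nu G.
Proof.
move=> packP cP packS kindS; have [tP dP] := packingP _ packP.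
have [tS dS] := packingP _ packS.
have uniqE A E E' : A \in S -> E \in te A -> E \in edges_in P -> E' \in te A ->
    E' \in edges_in P -> E = E'.
  move=> AS EA EP EA' EP'; have /eqP/cards1P[E0 e0] := kindS A AS.
  have : E' \in te A :&: edges_in P by rewrite in_setI EA'.
  have : E \in te A :&: edges_in P by rewrite in_setI EA.
  by rewrite e0 => /set1P-> /set1P->.
pose L : {set {set G} * {set G}} :=
  [set p | [&& p.1 \in P, p.2 \in S & hits p.2 (te p.1)]].
have LP p : p \in L -> [/\ p.1 \in P, p.2 \in S & hits p.2 (te p.1)].
  by rewrite in_set => /and3P[].
have covI A E : A \in P -> E \in te A -> E \in edges_in P.
  by move=> AP EA; apply/edges_inP; exists A.
have lL : linked P L.
  split=> [p /LP[p1P p2S hp]|p E /LP[p1P p2S /hitsP[E' E2 E1]] Ep EP|p p' E].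
  - split=> //; first exact: tS.
    apply/negP => p2P; have := kindS _ p2S; rewrite /kind (setIidPl _).
      by rewrite card_triangle_edges ?tS.
    exact: (bigcup_sup p.2).
  - by rewrite (uniqE p.2 E E') // (covI p.1).
  case/LP=> p1P p2S /hitsP[E1 E12 E11] /LP[p'1P p'2S /hitsP[E2 E22 E21]] Ep Ep'.
  have e2 : p.2 = p'.2 by apply: dS Ep Ep'.
  rewrite [p]surjective_pairing [p']surjective_pairing e2; congr (_, _).
  apply: (dP _ _ E1) => //; rewrite (uniqE p'.2 E1 E2) -?e2 //.
  - exact: covI E11.
  - by rewrite e2.
  - exact: covI E21.
have inj1 : {in L &, injective (fun p => p.1)}.
  move=> p p' pL p'L e1; apply/eqP; apply: contraT => pp'.
  have sK : [set p; p'] \subset L by rewrite subUset !sub1set pL p'L.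
  have lK := linkedS sK lL.
  have := packing_le_nu (exchange_packing packP lK).
  rewrite card_exchange // cards2 pp' imsetU1 imset_set1 e1 setUid cards1 cP.
  have [p1P _ _] := LP p pL.
  have : 0 < nu G by rewrite -cP; apply/card_gt0P; exists p.1.
  by clear; lia.
have sSL : S \subset [set p.2 | p in L].
  apply/subsetP => A AS.
  have /card_gt0P[E /setIP[EA /edges_inP[B BP EB]]] : 0 < #|te A :&: edges_in P|.
    by rewrite [#|_|]kindS.
  apply/imsetP; exists (B, A) => //; rewrite in_set BP AS /=.
  by apply/hitsP; exists E.
have cSL : #|S| <= #|L|.
  exact: leq_trans (subset_leq_card sSL) (leq_imset_card _ _).
have : tau G + #|L| <= 3 * #|P|; last by rewrite cP; move: cSL; setlia.
apply: exchange_cover => // K T sK tT.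
case: (boolP (hits _ _)) => // nT; exfalso.
have lK := linkedS sK lL; have pX := exchange_packing packP lK.
have := packing_le_nu (packingU1 pX tT nT).
have injK : {in K &, injective (fun p => p.1)}.
  by move=> p p' /(subsetP sK) pL /(subsetP sK) p'L; apply: inj1.
rewrite cardsU1 (notin_packing tT nT) card_exchange // (card_in_imset injK).
rewrite subnK; first by rewrite cP ltnn.
rewrite -(card_in_imset injK); exact: subset_leq_card (linked_sub1 lK).
Qed.

Lemma exists_pendant (G : sgraph) (P : {set {set G}}) :
  exists S : {set {set G}}, [/\ triangle_packing S,
    forall A, A \in S -> kind P A = 1 &
    forall T, T \in triangles G -> kind P T = 1 -> hits T (edges_in S)].
Proof.
pose ok (S : {set {set G}}) := triangle_packing S && [forall A in S, kind P A == 1].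
have ok0 : ok set0.
  apply/andP; split; first by apply/packingP; split=> [A|A B E]; rewrite inE.
  by apply/forall_inP => A; rewrite inE.
have [S /andP[pS /forall_inP kS] maxS] := arg_maxnP (fun R : {set {set G}} => #|R|) ok0.
exists S; split=> // [A /kS/eqP //|T tT k1].
case: (boolP (hits _ _)) => // nT; exfalso.
have : ok (T |: S).
  rewrite /ok packingU1 //=; apply/forall_inP => A /setU1P[->|/kS //].
  exact/eqP.
by move/maxS; rewrite /= cardsU1 notin_packing // ltnn.
Qed.

(** * The ratio *)

Lemma tau_le_nu54 (G : sgraph) : 19 * tau G <= 54 * nu G.
Proof.
have [P packP cP] := max_packing G; have [tP _] := packingP _ packP.
have hitP T : T \in triangles G -> hits T (edges_in P).
  move=> tT; case: (boolP (hits _ _)) => // nT; exfalso.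
  have := packing_le_nu (packingU1 packP tT nT).
  by rewrite cardsU1 notin_packing // cP ltnn.
have [S [packS kindS hitS]] := exists_pendant P.
have [F [N [L opt]]] := exists_optimal P packS.
have b1 := bound_pendant packP cP packS kindS.
have b2 := bound_exchange hitP kindS hitS opt.
have b3 := bound_greedy hitP packS hitS opt.
have b4 := bound_cut packP hitP packS kindS hitS opt.
have /packing_le_nu b5 : triangle_packing (S :|: F :|: N).
  by case: opt => /configP[].
have cfg : config P S F N L by case: opt.
move: b5; rewrite (card_config kindS cfg).
(* 5 times [b1], 9 times [b2], 3 times [b3] and once [b4] sum up to
   [19 * tau G <= 18 * nu G + 36 * (#|S| + #|F| + #|N|)]. *)
by move: b1 b2 b3 b4; rewrite cP; setlia.
Qed.

Lemma ler_nat_ratio (a b m n : nat) : 0 < b -> b * m <= a * n ->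
  (m%:R <= a%:R / b%:R * n%:R :> rat)%R.
Proof.
move=> b_gt0 le_mn.
rewrite GRing.mulrAC Num.Theory.ler_pdivlMr ?Num.Theory.ltr0n //.
by rewrite -!GRing.natrM Num.Theory.ler_nat mulnC.
Qed.

Theorem corollary1 (G : sgraph) :
  ((tau G)%:R <= (63%:R / 22%:R) * (nu G)%:R :> rat)%R.
Proof.
by apply: ler_nat_ratio => //; move: (tau_le_nu54 G); clear; lia.
Qed.
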